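(* Let $G$ be a finitely generated one-ended hyperbolic group. Then $\mathsf{wCop}(G)=\infty$ and $\mathsf{sCop}(G)=1$.
   Context: Graphs are undirected, without double edges and without loops. For a group $G$ generated by a finite set $S$, the Cayley graph $\Gamma(G,S)$ has vertex set $G$ and edge set all 2-element subsets $\{g,gs\}$ with $g\in G$, $s\in S$. For a finitely generated group $G$, $\mathsf{wCop}(G)=\mathsf{wCop}(\Gamma(G,S))$ and $\mathsf{sCop}(G)=\mathsf{sCop}(\Gamma(G,S))$, where $S$ is any finite generating set of $G$ (these values do not depend on $S$). $G$ is one-ended (resp. hyperbolic) if its Cayley graphs with respect to finite generating sets are. A connected graph $\Gamma$ is one-ended if for every finite set $K$ of vertices the subgraph induced by $V(\Gamma)\setminus K$ has exactly one unbounded connected component. A connected graph is hyperbolic if, regarded as a geodesic metric space with edges of length one, there is $\delta\ge0$ such that in every geodesic triangle each side lies in the $\delta$-neighborhood of the union of the other two sides. Game. For a connected graph $\Gamma$, $\mathsf{dist}$ is the path distance on $V(\Gamma)$. The cops and robber game on $\Gamma$ has parameters: number of cops $n$, cop speed $\sigma$, cop reach $\rho$, robber speed $\psi$, a vertex $v$, and a positive integer $R$. It is a perfect information game. First the $n$ cops choose initial vertices $c^1_0,\dots,c^n_0$; then, knowing these, the robber chooses an initial vertex $r_0$. In stage $k\ge 1$ each cop moves from $c^i_{k-1}$ to a vertex $c^i_k$ with $\mathsf{dist}(c^i_{k-1},c^i_k)\le\sigma$. The robber is captured during stage $k$ if $\mathsf{dist}(r_{k-1},c^i_k)\le\rho$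 for some $i$. If not captured, the robber moves from $r_{k-1}$ to a vertex $r_k$ such that there is a path from $r_{k-1}$ to $r_k$ of length at most $\psi$ all of whose vertices are at distance larger than $\rho$ from every $c^i_k$. The cops win (protect the $R$-ball centered at $v$) if the robber is captured at some stage or there is $N>0$ such that $\mathsf{dist}(v,r_k)>R$ for all $k\ge N$. $\Gamma$ is $\mathsf{CopWin}(n,\sigma,\rho,\psi,R)$ if for every vertex $v$ of $\Gamma$ the $n$ cops have a winning strategy in the game with parameters $n,\sigma,\rho,\psi,v,R$. $\Gamma$ is $n$-weak cop win if $\exists\,\sigma\in\mathbb{Z}_{>0}\ \exists\,\rho\in\mathbb{Z}_{\ge0}\ \forall\,\psi,R\in\mathbb{Z}_{>0}$: $\Gamma$ is $\mathsf{CopWin}(n,\sigma,\rho,\psi,R)$. $\Gamma$ is $n$-strong cop win if $\exists\,\sigma\in\mathbb{Z}_{>0}\ \forall\,\psi\in\mathbb{Z}_{>0}\ \exists\,\rho\in\mathbb{Z}_{\ge0}\ \forall\,R\in\mathbb{Z}_{>0}$: $\Gamma$ is $\mathsf{CopWin}(n,\sigma,\rho,\psi,R)$. The weak cop number $\mathsf{wCop}(\Gamma)$ (resp. strong cop number $\mathsf{sCop}(\Gamma)$) in $\mathbb{Z}_{>0}\cup\{\infty\}$ is the smallest positive integer $n$ such that $\Gamma$ is $n$-weak (resp. $n$-strong) cop win, and $\infty$ if there is none. *)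

(* Defs.v *)
From mathcomp Require Import all_boot all_order all_algebra.
From mathcomp Require Import boolp classical_sets reals.

Set Implicit Arguments.
Unset Strict Implicit.
Unset Printing Implicit Defensive.

Import Order.TTheory GRing.Theory Num.Theory.

Local Open Scope classical_set_scope.
Local Open Scope nat_scope.

Record graph := Graph {
  vertex :> eqType;
  adj : rel vertex;
  adj_sym : symmetric adj;
  adj_irrefl : irreflexive adj }.

Section Graph.
Variable X : graph.
Implicit Types (x y v : X) (p : seq X) (C K : set X).

(* [x :: p] is a path from x to y; its length is [size p]. *)
Definition is_path x y p : Prop := path (@adj X) x p /\ last x p = y.

Definition connected_graph : Prop := forall x y, exists p, is_path x y p.

Definition path_of_length x y (n : nat) : Prop :=
  exists2 p, is_path x y p & size p = n.

(* The value is the junk 0 if no path joins x to y; [dist] is only meaningful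
   on connected graphs. *)
Definition dist x y : nat :=
  if pselect (exists n, `[< path_of_length x y n >]) is left ex
  then ex_minn ex else 0.

Definition unbounded C : Prop :=
  forall n : nat, exists x y, [/\ C x, C y & n < dist x y].

Definition joined_outside K x y : Prop :=
  exists2 p, is_path x y p & forall z, z \in x :: p -> ~ K z.

Definition component_outside K C : Prop :=
  exists2 x, ~ K x & C = [set y | joined_outside K x y].

Definition one_ended : Prop :=
  connected_graph /\
  forall s : seq X,
    exists! C, component_outside [set` s] C /\ unbounded C.

End Graph.

Section Hyperbolic.
Variables (R : realType) (X : graph).
Local Open Scope ring_scope.

(* The point at distance [pos] from [src] on the edge [{src, tgt}].  The
   degenerate case [src = tgt], [pos = 0] is a vertex, so that a graph without
   edges still has its vertices as points. *)
Record rpoint := RPoint {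
  src : X;
  tgt : X;
  pos : R;
  rpointP : adj src tgt && (0 <= pos <= 1) || (src == tgt) && (pos == 0) }.

(* The length metric with edges of length one.  A point of the space has
   several representatives in [rpoint], e.g. (u, v, t) and (v, u, 1 - t); these
   are at distance 0, so that [rdist] is a pseudometric on [rpoint] whose
   metric quotient is the usual geodesic space. *)
Definition rdist (p q : rpoint) : R :=
  let: (u, v, s) := (src p, tgt p, pos p) in
  let: (u', v', s') := (src q, tgt q, pos q) in
  if (u == u') && (v == v') then `|s - s'|
  else if (u == v') && (v == u') then `|s - (1 - s')|
  else Num.min
    (Num.min (s + (dist u u')%:R + s') (s + (dist u v')%:R + (1 - s')))
    (Num.min (1 - s + (dist v u')%:R + s')
             (1 - s + (dist v v')%:R + (1 - s'))).

Definition geodesic_segment (p q : rpoint) (A : set rpoint) : Prop :=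
  exists f : R -> rpoint,
  let I := [set t : R | 0 <= t <= rdist p q] in
  [/\ f 0 = p, f (rdist p q) = q,
      forall s t, I s -> I t -> rdist (f s) (f t) = `|s - t|
    & A = f @` I].

Definition in_nbhd (delta : R) (A B : set rpoint) : Prop :=
  forall a, A a -> exists2 b, B b & rdist a b <= delta.

Definition hyperbolic : Prop :=
  connected_graph X /\
  exists2 delta : R, 0 <= delta &
    forall (p q r : rpoint) (A B C : set rpoint),
      geodesic_segment p q A -> geodesic_segment q r B ->
      geodesic_segment r p C ->
      [/\ in_nbhd delta A (B `|` C), in_nbhd delta B (C `|` A)
        & in_nbhd delta C (A `|` B)].

End Hyperbolic.

Section Game.
Variable X : graph.

(* [F [:: r_0; ...; r_(k-1)]] is the position of the cops in stage k, once the
   robber has occupied r_0, ..., r_(k-1); in particular [F [::]] is their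
   initial position, chosen before r_0.  The earlier positions of the cops
   are determined by F and the same history. *)
Definition cop_strategy (n : nat) := seq X -> 'I_n -> X.

Definition legal_strategy n (sigma : nat) (F : cop_strategy n) : Prop :=
  forall (h : seq X) (r : X) (i : 'I_n), dist (F h i) (F (rcons h r) i) <= sigma.

Definition cops_at n (F : cop_strategy n) (r : nat -> X) (k : nat) : 'I_n -> X :=
  F (mkseq r k).

(* The robber, at r_k when stage k+1 begins, is captured during that stage. *)
Definition captured n (rho : nat) (F : cop_strategy n) (r : nat -> X)
    (k : nat) : Prop :=
  exists i, dist (r k) (cops_at F r k.+1 i) <= rho.

(* The robber's move from r_k to r_(k+1) in stage k+1 is legal. *)
Definition legal_robber_move n (rho psi : nat) (F : cop_strategy n)
    (r : nat -> X) (k : nat) : Prop :=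
  exists p, [/\ is_path (r k) (r k.+1) p, size p <= psi
    & forall z, z \in r k :: p -> forall i, rho < dist z (cops_at F r k.+1 i)].

(* Plays are infinite sequences; after a capture the remaining entries are
   irrelevant and unconstrained. *)
Definition legal_play n (rho psi : nat) (F : cop_strategy n)
    (r : nat -> X) : Prop :=
  forall k, (forall j, j <= k -> ~ captured rho F r j) ->
    legal_robber_move rho psi F r k.

Definition winning_strategy n (rho psi : nat) (v : X) (R : nat)
    (F : cop_strategy n) : Prop :=
  forall r : nat -> X, legal_play rho psi F r ->
    (exists k, captured rho F r k) \/
    (exists2 N, 0 < N & forall k, N <= k -> R < dist v (r k)).

Definition CopWin (n sigma rho psi R : nat) : Prop :=
  forall v : X, exists2 F : cop_strategy n,
    legal_strategy sigma F & winning_strategy rho psi v R F.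

Definition weak_cop_win (n : nat) : Prop :=
  exists2 sigma, 0 < sigma & exists rho,
    forall psi R, 0 < psi -> 0 < R -> CopWin n sigma rho psi R.

Definition strong_cop_win (n : nat) : Prop :=
  exists2 sigma, 0 < sigma &
    forall psi, 0 < psi -> exists rho,
      forall R, 0 < R -> CopWin n sigma rho psi R.

End Game.

(* The smallest positive integer satisfying P, as an element of
   Z_{>0} + {infinity}; [None] stands for infinity. *)
Definition least_positive (P : nat -> Prop) : option nat :=
  if pselect (exists n, `[< 0 < n /\ P n >]) is left ex
  then Some (ex_minn ex) else None.

Definition wCop (X : graph) : option nat := least_positive (weak_cop_win X).

Definition sCop (X : graph) : option nat := least_positive (strong_cop_win X).

Section Cayley.
Variable G : groupType.
Implicit Types S : seq G.
Local Open Scope group_scope.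

Definition generates S : Prop :=
  forall g : G, exists2 w : seq G,
    (forall x, x \in w -> x \in S \/ x^-1 \in S) & g = \prod_(x <- w) x.

Definition cayley_adj S : rel G :=
  [rel g h | (g != h) && has (fun s => (h == g * s) || (g == h * s)) S].

Lemma cayley_adj_sym S : symmetric (cayley_adj S).
Proof.
move=> g h; rewrite /cayley_adj /= eq_sym; congr (_ && _).
by apply: eq_has => s; rewrite orbC.
Qed.

Lemma cayley_adj_irrefl S : irreflexive (cayley_adj S).
Proof. by move=> g; rewrite /cayley_adj /= eqxx. Qed.

Definition cayley S : graph :=
  Graph (@cayley_adj_sym S) (@cayley_adj_irrefl S).

Definition finitely_generated : Prop := exists S, generates S.

Definition one_ended_group : Prop :=
  forall S, generates S -> one_ended (cayley S).

Definition hyperbolic_group (R : realType) : Prop :=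
  forall S, generates S -> hyperbolic R (cayley S).

(* [c] is wCop(G), resp. sCop(G): the common value over all finite generating
   sets.  Since the independence of S is part of these predicates, they
   determine c as soon as G is finitely generated. *)
Definition wCop_group_is (c : option nat) : Prop :=
  forall S, generates S -> wCop (cayley S) = c.

Definition sCop_group_is (c : option nat) : Prop :=
  forall S, generates S -> sCop (cayley S) = c.

End Cayley.

(* Main.v *)
Require Import Defs.
From mathcomp Require Import all_boot all_order all_algebra.
From mathcomp Require Import boolp classical_sets reals.
From mathcomp Require Import zify lra.

(** The two equalities are theorems about graphs, applied to Cayley graphs,
    which are locally finite and vertex transitive.

    The weak cop number is infinite because in a one-ended, locally finite,
    vertex transitive graph [n] balls of bounded radius cannot separate two
    vertices that are far from all their centers, and the detour has bounded
    length: there are [D] and [e] such that any [x] and [y] at distance more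
    than [D] from the centers are joined by a path of length at most
    [dist x y + e] that avoids the [rho]-balls ([escape]).  For one ball this is
    one-endedness plus finiteness of spheres ([sphere_detour]).  For balls that
    are far apart, splice such a detour into a shortest path at each of them
    ([escape_separated]): a detour is too short to reach another ball.  If
    two centers are close, a larger ball around one of them swallows both
    [rho]-balls, and an induction on the number of centers applies.  On the
    other hand [n] balls of radius [D + sigma] cannot cover a large ball around
    [v] ([far_vertex_in_ball]).  So a robber who is fast enough never leaves this
    large ball: after each move of the cops he runs to a vertex of it at
    distance more than [D + sigma] from them, and they cannot come closer than
    [D] in one move ([one_ended_not_weak_cop_win]).

    The strong cop number is one because in a hyperbolic graph a single cop
    starting at [v] can march outwards, being after stage [k] at distance [k]
    from [v] on a geodesic from [v] to the robber.  When the robber moves by at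
    most [psi], the new geodesic stays [2 * delta]-close to the old one except
    near its end ([fellow_travel]), so that the cop can step on it with
    speed [2 * delta + 1]; and if the cop comes near that end, he captures
    the robber, provided that [rho] exceeds [psi + delta].  A robber who is
    never captured is thus at distance more than [k] from [v] after stage [k]
    ([hyperbolic_strong_cop_win]). *)

Set Implicit Arguments.
Unset Strict Implicit.
Unset Printing Implicit Defensive.

Local Open Scope nat_scope.

(** * Paths, distance and geodesics *)

Section Paths.
Variable X : graph.
Implicit Types (x y z c : X) (p q : seq X).

Lemma is_path_cat x y z p q :
  is_path x y p -> is_path y z q -> is_path x z (p ++ q).
Proof.
by case=> xp <- [yq <-]; split; rewrite ?cat_path ?last_cat // xp.
Qed.

Lemma is_path_rev x y p : is_path x y p -> is_path y x (rev (belast x p)).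
Proof.
case=> xp <-; split; last by case: p xp => //= z p _; rewrite rev_cons last_rcons.
rewrite rev_path; apply: sub_path xp => u v /=; by rewrite adj_sym.
Qed.

Lemma dist_le_size x y p : is_path x y p -> dist x y <= size p.
Proof.
move=> xyp; rewrite /dist; case: pselect => [ex|[]].
  by case: ex_minnP => m _; apply; apply/asboolP; exists p.
by exists (size p); apply/asboolP; exists p.
Qed.

Lemma dist_xx x : dist x x = 0.
Proof. by apply/eqP; rewrite -leqn0 (@dist_le_size x x [::]). Qed.

Lemma dist_adj x y : adj x y -> dist x y <= 1.
Proof. by move=> xy; apply: (@dist_le_size x y [:: y]); split; rewrite //= xy. Qed.

Hypothesis conX : connected_graph X.

Lemma shortest_path x y : exists2 p, is_path x y p & size p = dist x y.
Proof.
suff: path_of_length x y (dist x y) by [].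
rewrite /dist; case: pselect => [ex|[]].
  by case: ex_minnP => m /asboolP.
by have [p xyp] := conX x y; exists (size p); apply/asboolP; exists p.
Qed.

Lemma dist_sym x y : dist x y = dist y x.
Proof.
wlog suff: x y / dist y x <= dist x y by move=> H; apply/eqP; rewrite eqn_leq !H.
have [p /is_path_rev/dist_le_size le_p <-] := shortest_path x y.
by rewrite size_rev size_belast in le_p.
Qed.

Lemma dist_triangle y x z : dist x z <= dist x y + dist y z.
Proof.
have [p xyp <-] := shortest_path x y; have [q yzq <-] := shortest_path y z.
by rewrite -size_cat; apply/dist_le_size/(is_path_cat xyp).
Qed.

Lemma dist_eq0 x y : dist x y = 0 -> x = y.
Proof. by have [p [_ xy] <-] := shortest_path x y => /size0nil p0; rewrite p0 in xy. Qed.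

Lemma dist_mem_path x p z : path (@adj X) x p -> z \in x :: p -> dist x z <= size p.
Proof.
rewrite inE => xp /predU1P[->|/splitPr zp]; first by rewrite dist_xx.
case: zp xp => p1 p2; rewrite -cat_rcons cat_path => /andP[xp1 _].
apply: leq_trans (@dist_le_size _ _ (rcons p1 z) _) _.
  by split; rewrite ?last_rcons.
by rewrite size_cat leq_addr.
Qed.

Lemma dist_mem_path_last x p z :
  path (@adj X) x p -> z \in x :: p -> dist z (last x p) <= size p.
Proof.
move=> xp zp; have [yp _] := is_path_rev (conj xp erefl).
rewrite dist_sym -(size_belast x p) -size_rev; apply: dist_mem_path yp _.
by rewrite -rev_rcons -lastI mem_rev.
Qed.

Definition geodesic (w : nat -> X) n :=
  forall i j, i <= j <= n -> dist (w i) (w j) = j - i.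

(** Two vertices of the path at distance less than [j - i] would give a shortcut
    from [x] to [y]. *)
Lemma shortest_path_geodesic x y p :
  is_path x y p -> size p = dist x y -> geodesic (nth y (x :: p)) (dist x y).
Proof.
move=> [xp xyp] sz i j /andP[ij jn].
have sub i' j' : i' <= j' <= dist x y ->
    dist (nth y (x :: p) i') (nth y (x :: p) j') <= j' - i'.
  move=> /andP[]; elim: j' => [|j' IH]; first by case: i' => // _ _; rewrite dist_xx.
  rewrite leq_eqVlt => /predU1P[<-|ij' j'n]; first by rewrite dist_xx.
  rewrite subSn //; apply: leq_trans (dist_triangle (nth y (x :: p) j') _ _) _.
  rewrite -[X in _ <= X]addn1 leq_add ?IH //; first exact: ltnW.
  by apply: dist_adj; apply: (pathP y xp); rewrite sz.
have w0 : nth y (x :: p) 0 = x by [].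
have wn : nth y (x :: p) (dist x y) = y by rewrite -sz nth_last /= xyp.
have := sub 0 i; have := sub i j; have := sub j (dist x y).
rewrite w0 wn.
have := dist_triangle (nth y (x :: p) i) x y.
have := dist_triangle (nth y (x :: p) j) (nth y (x :: p) i) y.
rewrite ij jn (leq_trans ij jn) leqnn /=; lia.
Qed.

End Paths.

(** * Detours around one ball *)

(** The form in which local finiteness is used: constants that exist for each
    vertex of a ball can be chosen independent of the vertex. *)
Lemma uniform_bound (T : eqType) (P : T -> nat -> Prop) (s : seq T) :
  (forall x m n, m <= n -> P x m -> P x n) ->
  (forall x, x \in s -> exists n, P x n) ->
  exists N, forall x, x \in s -> P x N.
Proof.
move=> Pmono; elim: s => [|x s IH] Ps; first by exists 0.
have [N PN] : exists N, forall y, y \in s -> P y N.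
  by apply: IH => y ys; apply: Ps; rewrite inE ys orbT.
have [n Pn] := Ps x (mem_head _ _).
exists (maxn n N) => y; rewrite inE => /predU1P[->|ys].
  by apply: Pmono Pn; apply: leq_maxl.
by apply: Pmono (PN y ys); apply: leq_maxr.
Qed.

Definition locally_finite (X : graph) :=
  forall x : X, exists s : seq X, forall y, adj x y -> y \in s.

(** An automorphism is given with its inverse, which is then one as well. *)
Definition vertex_transitive (X : graph) := forall x y : X,
  exists f g : X -> X,
    [/\ cancel f g, cancel g f, {mono f : a b / adj a b} & f x = y].

Section Ends.
Variable X : graph.
Implicit Types (x y z c o : X) (p q C : seq X) (rho : nat).

Lemma joined_outside_sym (K : set X) x y :
  joined_outside K x y -> joined_outside K y x.
Proof.
case=> p xyp pK; exists (rev (belast x p)); first exact: is_path_rev.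
by case: (xyp) => _ <- z; rewrite -rev_rcons -lastI mem_rev => /pK.
Qed.

Lemma joined_outside_trans (K : set X) y x z :
  joined_outside K x y -> joined_outside K y z -> joined_outside K x z.
Proof.
case=> p xyp pK [q yzq qK]; exists (p ++ q); first exact: is_path_cat yzq.
move=> u; rewrite -cat_cons mem_cat => /orP[/pK//|uq].
by apply: qK; rewrite inE uq orbT.
Qed.

Lemma map_is_path (f : X -> X) x y p :
  {mono f : a b / adj a b} -> is_path x y p -> is_path (f x) (f y) (map f p).
Proof.
move=> fm [xp <-]; split; last by rewrite last_map.
by rewrite path_map; apply: sub_path xp => a b /=; rewrite fm.
Qed.

Hypothesis conX : connected_graph X.

Lemma dist_automorphism (f g : X -> X) : cancel f g -> cancel g f ->
  {mono f : a b / adj a b} -> forall x y, dist (f x) (f y) = dist x y.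
Proof.
move=> fK gK fm x y.
have nonexpanding (h : X -> X) a b : {mono h : a b / adj a b} ->
    dist (h a) (h b) <= dist a b.
  move=> hm; have [p abp <-] := shortest_path conX a b.
  by rewrite -(size_map h p); apply/dist_le_size/map_is_path.
have gm : {mono g : a b / adj a b} by move=> a b; rewrite -fm !gK.
apply/eqP; rewrite eqn_leq nonexpanding //.
by rewrite -{1}[x]fK -{1}[y]fK nonexpanding.
Qed.

Lemma finite_ball : locally_finite X ->
  forall o m, exists s : seq X, forall y, dist o y <= m -> y \in s.
Proof.
move=> lfX o; elim=> [|m [s sP]].
  by exists [:: o] => y; rewrite leqn0 => /eqP/(dist_eq0 conX)->; rewrite mem_head.
have [t tP] : exists t : seq X, forall x, x \in s -> forall y, adj x y -> y \in t.
  elim: s {sP} => [|x s [t tP]]; first by exists [::].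
  have [t' t'P] := lfX x; exists (t' ++ t) => y.
  rewrite inE => /predU1P[->|ys] z yz; rewrite mem_cat; first by rewrite t'P.
  by rewrite (tP y ys) ?orbT.
exists (s ++ t) => y oy; rewrite mem_cat.
have [p [op oyp] szp] := shortest_path conX o y.
case/lastP: p => [|p z] in op oyp szp *.
  by rewrite -oyp /= sP ?dist_xx.
rewrite last_rcons in oyp; rewrite {z}oyp in op szp.
rewrite rcons_path in op; case/andP: op => op py.
have /sP ps : dist o (last o p) <= m.
  apply: leq_trans (@dist_le_size _ _ _ p _) _; first by split.
  by rewrite -ltnS -(size_rcons p y) szp.
by rewrite (tP _ ps) ?orbT.
Qed.

Definition detour rho E e c := forall u w, dist u c = E -> dist w c = E ->
  exists p, [/\ is_path u w p, size p <= e
              & forall z, z \in u :: p -> rho < dist z c].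

(** Only finitely many components of the complement of the [rho]-ball around
    [o] meet the [rho.+1]-ball, so the bounded ones among them lie within some
    distance of [o].  A shortest path from [o] to a vertex [u] beyond that
    distance leaves the [rho]-ball for good at distance [rho.+1] and shows that
    [u] lies in the unbounded component.  The spheres being finite, the lengths
    of the detours are bounded. *)
Lemma sphere_detour_at o rho : one_ended X -> locally_finite X ->
  exists E e, rho < E /\ detour rho E e o.
Proof.
move=> [_ oneX] lfX.
have [B BP] := finite_ball lfX o rho.+1.
pose K := [seq z <- B | dist o z <= rho].
have KP z : (z \in K) = (dist o z <= rho).
  by rewrite mem_filter; case: leqP => //= le; rewrite BP // ltnW.
pose Cmp z := [set y | joined_outside [set` K] z y]%classic.
have [b bP] : exists b, forall z, z \in B ->
    unbounded (Cmp z) \/ forall y, Cmp z y -> dist z y <= b.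
  apply: uniform_bound.
    by move=> z m n mn [|le]; [left | right=> y /le zy; apply: leq_trans mn].
  move=> z _; have [|bd] := pselect (unbounded (Cmp z)); first by exists 0; left.
  have [zK|zK] := boolP (z \in K).
    exists 0; right=> y [p zyp pK].
    by case: (pK z (mem_head _ _)).
  move/existsNP: bd => [n nP]; exists n; right=> y zy.
  rewrite leqNgt; apply/negP => lt; apply: nP; exists z, y; split=> //.
  exists [::]; first by split.
  by move=> t; rewrite inE => /eqP-> /=; apply/negP.
pose E := rho.+2 + b.
have far_unbounded u : dist u o = E -> unbounded (Cmp u) /\ u \notin K.
  move=> uoE; have ouE : dist o u = E by rewrite (dist_sym conX).
  have uK : u \notin K by rewrite KP ouE -ltnNge /E; lia.
  split=> //.
  have [p [op oup] szp] := shortest_path conX o u.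
  have szp1 : size (take rho.+1 p) = rho.+1 by rewrite size_takel // szp ouE /E; lia.
  have szp2 : size (drop rho.+1 p) = E - rho.+1 by rewrite size_drop szp ouE.
  have := op; rewrite -{1}(cat_take_drop rho.+1 p) cat_path.
  have := oup; rewrite -{1}(cat_take_drop rho.+1 p) last_cat.
  set p1 := take _ p in szp1 *; set p2 := drop _ p in szp2 *; set z := last o p1.
  move=> zu /andP[op1 zp2].
  have oz : dist o z <= rho.+1 by rewrite -szp1; apply: dist_le_size.
  have ozu := dist_triangle conX z o u.
  have joined_zu : joined_outside [set` K] z u.
    exists p2; first by split.
    move=> t tp2 /=; rewrite KP.
    have := dist_mem_path_last conX zp2 tp2; rewrite zu szp2.
    have := dist_triangle conX t o u; rewrite ouE /E; lia.
  case: (bP z (BP z oz)) => [unb|/(_ _ joined_zu)]; last first.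
    by move: ozu; rewrite ouE /E; lia.
  move=> n; have [x [y [zx zy xy]]] := unb n; exists x, y.
  by split=> //; apply: joined_outside_trans (joined_outside_sym joined_zu) _.
have joined u w : dist u o = E -> dist w o = E -> joined_outside [set` K] u w.
  move=> /far_unbounded[unbu uK] /far_unbounded[unbw wK].
  have [C [_ Cuniq]] := oneX K.
  have Cu : C = Cmp u.
    by apply: Cuniq; split=> //; exists u => //; apply/negP.
  have Cw : C = Cmp w.
    by apply: Cuniq; split=> //; exists w => //; apply/negP.
  suff : Cmp u w by [].
  rewrite -Cu Cw; exists [::]; first by split.
  by move=> t; rewrite inE => /eqP-> /=; apply/negP.
have [S SP] := finite_ball lfX o E.
have [e eP] : exists e, forall u, u \in S -> forall w, w \in S ->
    dist u o = E -> dist w o = E ->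
    exists p, [/\ is_path u w p, size p <= e
                & forall z, z \in u :: p -> rho < dist z o].
  apply: uniform_bound => [u m n mn H w wS uE wE|u uS].
    have [p [uwp szp pK]] := H w wS uE wE; exists p; split=> //.
    exact: leq_trans mn.
  apply: uniform_bound => [w m n mn H uE wE|w wS].
    have [p [uwp szp pK]] := H uE wE; exists p; split=> //.
    exact: leq_trans mn.
  have [uE|] := pselect (dist u o = E); last by exists 0.
  have [wE|] := pselect (dist w o = E); last by exists 0.
  have [p uwp pK] := joined u w uE wE.
  exists (size p) => _ _; exists p; split=> // z /pK /=.
  by rewrite KP (dist_sym conX) ltnNge => /negP.
exists E, e; split; first by rewrite /E; lia.
by move=> u w uE wE; apply: eP => //; apply: SP; rewrite (dist_sym conX) ?uE ?wE.
Qed.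

(** Automorphisms carry the detours around one vertex to every other vertex, with
    the same constants. *)
Lemma sphere_detour rho :
  one_ended X -> locally_finite X -> vertex_transitive X ->
  exists E e, rho < E /\ forall c, detour rho E e c.
Proof.
move=> oneX lfX vtX.
have [[o _]|noX] := pselect (exists o : X, True); last first.
  by exists rho.+1, 0; split=> // c; case: noX; exists c.
have [E [e [ltE det]]] := sphere_detour_at o rho oneX lfX.
exists E, e; split=> // c u w uE wE; have [f [g [fK gK fm fc]]] := vtX c o.
have df := dist_automorphism fK gK fm.
have gm : {mono g : a b / adj a b} by move=> a b; rewrite -fm !gK.
have [||p [uwp szp pK]] := det (f u) (f w); rewrite -?fc ?df //.
exists (map g p); split; rewrite ?size_map //.
  by rewrite -[u]fK -[w]fK; apply: map_is_path.
move=> z; rewrite -{1}[u]fK -map_cons => /mapP[t tp ->].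
by rewrite -df fc gK pK.
Qed.

End Ends.

(** * Escaping finitely many cops *)

Section Escape.
Variable X : graph.
Hypothesis conX : connected_graph X.
Implicit Types (x y z c : X) (p q C : seq X) (rho : nat).

(** Distances to [c] change by at most one along a path, so the path enters the
    [E]-ball exactly on the sphere of radius [E], where detours begin. *)
Lemma first_entry c E x p : path (@adj X) x p -> E < dist x c ->
  (forall z, z \in x :: p -> E < dist z c) \/
  exists p1 u p2, [/\ p = p1 ++ u :: p2, dist u c = E
                    & forall z, z \in x :: p1 -> E < dist z c].
Proof.
elim: p x => [|y p IH] x /=; first by left=> z; rewrite inE => /eqP->.
case/andP=> xy yp Ex; have [Ey|yE] := ltnP E (dist y c).
  have [farp|[p1 [u [p2 [-> uE far]]]]] := IH y yp Ey.
    by left=> z; rewrite inE => /predU1P[->|/farp].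
  right; exists (y :: p1), u, p2; split=> // z.
  by rewrite inE => /predU1P[->|/far].
right; exists [::], y, p; split=> //; last by move=> z; rewrite inE => /eqP->.
by have := dist_triangle conX y x c; have := dist_adj xy; lia.
Qed.

Lemma last_exit c E u p : path (@adj X) u p -> dist u c <= E ->
  E < dist (last u p) c ->
  exists p1 p2, [/\ p = p1 ++ p2, dist (last u p1) c = E
                  & forall z, z \in p2 -> E < dist z c].
Proof.
move=> up uE; elim/last_ind: p up => [|p z IH] /=; first by lia.
rewrite rcons_path last_rcons => /andP[up pz] zE.
have [pE|Ep] := leqP (dist (last u p) c) E.
  exists p, [:: z]; rewrite cats1; split=> //; last by move=> t; rewrite inE => /eqP->.
  have := dist_triangle conX (last u p) z c; rewrite (dist_sym conX z (last u p)).
  by have := dist_adj pz; rewrite /=; lia.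
have [p1 [p2 [-> exitE far]]] := IH up Ep.
exists p1, (rcons p2 z); split=> //; first by rewrite -rcons_cat.
by move=> t; rewrite mem_rcons inE => /predU1P[->|/far].
Qed.

(** Replace the part of the path between its first and its last visit to the
    [E]-ball around [c].  The new vertices stay within [E + e] of [c]: this keeps
    them away from balls around other, distant centers. *)
Lemma splice_detour rho E e c x y p : rho < E -> detour rho E e c ->
  is_path x y p -> E < dist x c -> E < dist y c ->
  exists q, [/\ is_path x y q, size q <= size p + e
    & forall z, z \in x :: q ->
        rho < dist z c /\ (z \in x :: p \/ dist z c <= E + e)].
Proof.
move=> ltE det [xp pxy] xE yE.
have [far|[p1 [u [p' [pE uE far1]]]]] := first_entry xp xE.
  exists p; split=> //; first exact: leq_addr.
  by move=> z zp; split; [apply: ltn_trans ltE _; apply: far | left].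
move: xp pxy; rewrite pE cat_path last_cat /= => /and3P[xp1 p1u up'] p'y.
rewrite -p'y in yE; have [|d1 [p2 [p'E wE far2]]] := last_exit up' _ yE.
  by rewrite uE.
have [d [[ud dw] szd dfar]] := det u _ uE wE.
move: up' p'y; rewrite p'E cat_path last_cat => /andP[_ wp2] p2y.
exists (p1 ++ u :: d ++ p2); split.
- by split; rewrite ?cat_path ?last_cat /= ?cat_path ?last_cat ?dw // xp1 p1u ud.
- by rewrite !size_cat /= !size_cat; lia.
move=> z; rewrite -cat_cons mem_cat -cat_cons mem_cat => /or3P[zp1|zd|zp2].
- split; first by have := far1 z zp1; lia.
  by left; rewrite -cat_cons mem_cat zp1.
- split; first exact: dfar.
  right; have := dist_mem_path ud zd; have := dist_triangle conX u z c.
  by rewrite (dist_sym conX z u); lia.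
split; first by have := far2 z zp2; lia.
by left; rewrite inE mem_cat inE mem_cat zp2 !orbT.
Qed.

Lemma escape_separated rho E e C : rho < E -> (forall c, detour rho E e c) ->
  pairwise (fun c c' => E + e + rho < dist c c') C ->
  forall x y, (forall c, c \in C -> E < dist x c /\ E < dist y c) ->
  exists p, [/\ is_path x y p, size p <= dist x y + size C * e
    & forall z, z \in x :: p -> forall c, c \in C -> rho < dist z c].
Proof.
move=> ltE det; elim: C => [|c C IH] /=.
  move=> _ x y _; have [p xyp szp] := shortest_path conX x y.
  by exists p; rewrite szp addn0.
case/andP=> /allP sepc sepC x y far; have [xE yE] := far c (mem_head _ _).
have [|p [xyp szp pfar]] := IH sepC x y.
  by move=> c' c'C; apply: far; rewrite inE c'C orbT.
have [q [xyq szq qfar]] := splice_detour ltE (det c) xyp xE yE.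
exists q; split=> //; first by rewrite mulSn; lia.
move=> z zq c'; have [zc zor] := qfar z zq; rewrite inE => /predU1P[->//|c'C].
have [zp|zE] := zor; first exact: pfar.
have := sepc c' c'C; have := dist_triangle conX z c c'.
by rewrite (dist_sym conX c z); lia.
Qed.

(** If two points of [C] are close, one of them can stand for the other, at the
    price of enlarging the balls by [L]. *)
Lemma drop_close_point (L : nat) C :
  ~~ pairwise (fun c c' => L < dist c c') C ->
  exists C', [/\ size C' < size C, {subset C' <= C}
    & forall c, c \in C -> exists2 c', c' \in C' & dist c c' <= L].
Proof.
elim: C => //= c C IH; rewrite negb_and => /orP[/allPn[c' c'C cc']|/IH].
  exists C; split=> //; first by move=> z zC; rewrite inE zC orbT.
  move=> z; rewrite inE => /predU1P[->|zC]; first by exists c'; rewrite // leqNgt.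
  by exists z; rewrite ?dist_xx.
case=> C' [szC' subC' near]; exists (c :: C'); split=> //.
  by move=> z; rewrite !inE => /predU1P[->|/subC'->]; rewrite ?eqxx ?orbT.
move=> z; rewrite inE => /predU1P[->|/near[c' c'C zc']].
  by exists c; rewrite ?mem_head ?dist_xx.
by exists c'; rewrite // inE c'C orbT.
Qed.

(** The constants must not depend on the mutual position of the centers.  The
    induction on their number compares their distances with the reach [E + e + rho]
    of the detours: beyond it detours do not interfere, below it one
    center can be dropped. *)
Lemma escape : one_ended X -> locally_finite X -> vertex_transitive X ->
  forall n rho, exists D e, rho <= D /\ forall C, size C <= n ->
  forall x y, (forall c, c \in C -> D < dist x c /\ D < dist y c) ->
  exists p, [/\ is_path x y p, size p <= dist x y + e
    & forall z, z \in x :: p -> forall c, c \in C -> rho < dist z c].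
Proof.
move=> oneX lfX vtX; elim=> [|n IH] rho.
  exists rho, 0; split=> // C; rewrite leqn0 => /nilP-> x y _.
  by have [p xyp szp] := shortest_path conX x y; exists p; rewrite szp addn0.
have [E [e [ltE det]]] := sphere_detour conX rho oneX lfX vtX.
pose L := E + e + rho.
have [D' [e' [leD' esc]]] := IH (rho + L).
exists (maxn E D'), (n.+1 * e + e'); split; first by rewrite leq_max ltnW.
move=> C szC x y far.
have [sepC|/drop_close_point[C' [szC' subC' near]]] :=
  boolP (pairwise (fun c c' => L < dist c c') C).
  have [|p [xyp szp pfar]] := escape_separated ltE det sepC (x := x) (y := y).
    by move=> c /far; rewrite !gtn_max => -[/andP[-> _] /andP[-> _]].
  exists p; split=> //; apply: leq_trans szp _.
  by rewrite leq_add2l (leq_trans _ (leq_addr _ _)) // leq_mul2r szC orbT.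
have [||p [xyp szp pfar]] := esc C' _ x y.
- by rewrite -ltnS (leq_trans szC').
- by move=> c /subC'/far; rewrite !gtn_max => -[/andP[_ ->] /andP[_ ->]].
exists p; split=> //; first by apply: leq_trans szp _; lia.
move=> z zp c /near[c' c'C cc'].
by have := pfar z zp c' c'C; have := dist_triangle conX c z c'; lia.
Qed.

(** Among [n.+1] points of a geodesic at mutual distances more than [2 * D], two
    would be in the same ball of radius [D]. *)
Lemma far_vertex_in_ball : (exists C : set X, unbounded C) ->
  forall (v : X) n D, exists R, forall c : 'I_n -> X,
  exists x, dist v x <= R /\ forall i, D < dist x (c i).
Proof.
case=> C unbC v n D; pose m := D.*2.+1; exists (n * m) => c.
have [w [w0 geow]] : exists w, w 0 = v /\ geodesic w (n * m).
  have [x [y [_ _ xy]]] := unbC (n * m).*2.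
  have [z vz] : exists z, n * m <= dist v z.
    have := dist_triangle conX v x y; rewrite (dist_sym conX x v).
    by have [|lt] := leqP (n * m) (dist v x); [exists x | exists y; lia].
  have [p vzp szp] := shortest_path conX v z.
  have geop := shortest_path_geodesic conX vzp szp.
  exists (nth z (v :: p)); split=> // i j /andP[ij jn].
  by apply: geop; rewrite ij (leq_trans jn).
apply: contrapT => noX.
have near (j : 'I_n.+1) : exists i, dist (w (j * m)) (c i) <= D.
  apply: contrapT => far; apply: noX; exists (w (j * m)); split.
    by rewrite -w0 geow ?subn0 /= leq_mul2r -ltnS ltn_ord orbT.
  by move=> i; rewrite ltnNge; apply/negP => le; apply: far; exists i.
have [f fP] := choice near.
suff /leq_card : injective f by rewrite !card_ord ltnn.
move=> j k fjk; apply: val_inj; have := fP j; have := fP k; rewrite -fjk => kD jD.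
wlog lejk : j k fjk kD jD / j <= k.
  move=> H; case/orP: (leq_total j k) => [/H->//|/H kj].
  by symmetry; apply: kj; rewrite // -fjk.
have jk : dist (w (j * m)) (w (k * m)) <= D.*2.
  have := dist_triangle conX (c (f j)) (w (j * m)) (w (k * m)).
  by rewrite (dist_sym conX (c (f j))); lia.
move: jk; rewrite geow; last first.
  by rewrite !leq_mul2r lejk -ltnS ltn_ord !orbT.
rewrite -mulnBl => lt; apply/eqP; rewrite eqn_leq lejk -subn_eq0 /=.
by case: (k - j) lt => // d; rewrite mulSn /m; lia.
Qed.

(** The robber's play and the cops' positions determine each other stage by
    stage. *)
Lemma reply_play n (F : cop_strategy X n) (s : ('I_n -> X) -> X) :
  exists r : nat -> X, forall k, r k = s (F (mkseq r k)).
Proof.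
pose h := fix h k := if k is k'.+1 then rcons (h k') (s (F (h k'))) else [::].
exists (fun k => s (F (h k))) => k; congr (s (F _)).
by elim: k => //= k IH; rewrite mkseqS -IH.
Qed.

(** The safety margin is [D + sigma]: the cops move before the robber does, and
    he must still be at distance more than [D] from them when he starts to run. *)
Theorem one_ended_not_weak_cop_win n :
  one_ended X -> locally_finite X -> vertex_transitive X -> X ->
  ~ weak_cop_win X n.
Proof.
move=> oneX lfX vtX v [sigma _ [rho copwin]].
have [D [e [leD esc]]] := escape oneX lfX vtX n rho.
have unbX : exists C : set X, unbounded C.
  by have [_ /(_ [::])[C [[_ unbC] _]]] := oneX; exists C.
have [R dodgeR] := far_vertex_in_ball unbX v n (D + sigma).
have [s sP] := choice dodgeR.
have [F legF winF] := copwin (R.*2 + e).+1 R.+1 isT isT v.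
have [r rP] := reply_play F s.
have far_now k i : D + sigma < dist (r k) (cops_at F r k i).
  by rewrite rP; apply: (sP _).2.
have inball k : dist v (r k) <= R by rewrite rP; apply: (sP _).1.
have far_next k i : D < dist (r k) (cops_at F r k.+1 i).
  have := legF (mkseq r k) (r k) i; rewrite -mkseqS -/(cops_at F r k i).
  rewrite -/(cops_at F r k.+1 i).
  have := dist_triangle conX (cops_at F r k.+1 i) (r k) (cops_at F r k i).
  by have := far_now k i; rewrite (dist_sym conX (cops_at F r k i)); lia.
have [|[k [i]]|[N _ /(_ N (leqnn N))]] := winF r.
- move=> k _; pose C := codom (cops_at F r k.+1).
  have [||p [rp szp pfar]] := esc C _ (r k) (r k.+1).
  + by rewrite size_codom card_ord.
  + move=> _ /codomP[i ->]; split=> //.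
    by apply: leq_ltn_trans (far_now k.+1 i); apply: leq_addr.
  exists p; split=> //.
    have := dist_triangle conX v (r k) (r k.+1); have := inball k.
    by have := inball k.+1; rewrite (dist_sym conX v (r k)); lia.
  by move=> z zp i; apply: pfar; rewrite ?codom_f.
- by have := far_next k i; lia.
by have := inball N; lia.
Qed.

End Escape.

(** * Thin triangles with vertices as corners *)

Section ThinTriangles.
Variables (R : realType) (X : graph).
Hypothesis conX : connected_graph X.
Import Order.TTheory GRing.Theory Num.Theory.
Local Open Scope ring_scope.
Implicit Types (x y : X) (p q : rpoint R X) (w : nat -> X).

Lemma vert_subproof x :
  adj x x && ((0 : R) <= (0 : R) <= 1) || (x == x) && ((0 : R) == 0).
Proof. by rewrite !eqxx orbT. Qed.

(** The only representatives of vertices that are used: corners shared by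
    several geodesic segments must be equal, not only at distance 0. *)
Definition vert x : rpoint R X := RPoint (vert_subproof x).

Lemma rpoint_ext p q :
  src p = src q -> tgt p = tgt q -> pos p = pos q -> p = q.
Proof.
case: p q => [u v s H] [u' v' s' H'] /= uu vv ss; subst.
by congr RPoint; apply: bool_irrelevance.
Qed.

Lemma rdist_sym p q : rdist p q = rdist q p.
Proof.
rewrite /rdist /= ![src q == _]eq_sym ![tgt q == _]eq_sym [_ && (src p == tgt q)]andbC.
case: ifP => _; first exact: distrC.
case: ifP => _; first by congr `|_|; lra.
rewrite minACA !(dist_sym conX (src q)) !(dist_sym conX (tgt q)).
congr (Num.min (Num.min _ _) (Num.min _ _)); lra.
Qed.

Lemma rdist_vert x y : rdist (vert x) (vert y) = (dist x y)%:R.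
Proof.
rewrite /rdist /= andbb eq_sym; case: eqP => [->|_].
  by rewrite dist_xx subrr normr0.
have d0 : 0 <= (dist x y)%:R :> R by apply: ler0n.
by apply/eqP; rewrite eq_le !le_min !ge_min; lra.
Qed.

(** [p] is the point at distance [t] from [w 0] on the polygon through
    [w 0], ..., [w n].  Vertices are represented by [vert], which makes [p]
    unique. *)
Definition along w n (t : R) p := exists i : nat,
  [/\ t = i%:R + pos p, 0 <= pos p < 1, src p = w i,
      tgt p = w (i + (pos p != 0%R))%N & (i + (pos p != 0%R) <= n)%N].

Lemma along_exists w n (t : R) : geodesic w n -> 0 <= t <= n%:R ->
  exists p, along w n t p.
Proof.
move=> geow /andP[t0 tn]; pose i := Num.truncn t.
have /andP[it ti] : i%:R <= t < i.+1%:R by apply: truncn_itv.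
have [ti0|ti0] := eqVneq (t - i%:R) 0.
  exists (vert (w i)), i; rewrite /= eqxx addn0 lexx ltr01; split=> //; first by lra.
  by rewrite -(ler_nat R) (le_trans it).
have lt : (i < n)%N by rewrite -(ltr_nat R); lra.
have adjw : adj (w i) (w i.+1).
  have [p [wp pw]] := shortest_path conX (w i) (w i.+1).
  rewrite geow ?leqnSn // subSnn; case: p wp pw => [|z [|//]] //= /andP[+ _].
  by move=> wz <- _.
have H : adj (w i) (w i.+1) && (0 <= t - i%:R <= 1) ||
    (w i == w i.+1) && (t - i%:R == 0).
  by rewrite adjw /=; apply/orP; left; rewrite -natr1 in ti; lra.
rewrite -natr1 in ti.
by exists (RPoint H), i; rewrite /= ti0 addn1; split=> //; lra.
Qed.

(** With [w i] before [w j], the minimum in [rdist] is attained by the way through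
    the next vertex after [p], or [p] itself if it is a vertex, and [src q]. *)
Lemma rdist_along w n s t p q : geodesic w n ->
  along w n s p -> along w n t q -> rdist p q = `|s - t|.
Proof.
move=> geow [i [-> /andP[p0 p1] pu pv ni]] [j [-> /andP[q0 q1] qu qv nj]].
wlog leij : i j p q p0 p1 pu pv ni q0 q1 qu qv nj / (i <= j)%N.
  move=> H; case/orP: (leq_total i j) => [/H->//|/H H'].
  by rewrite rdist_sym H' // distrC.
have w_eq a b : (a <= n)%N -> (b <= n)%N -> (w a == w b) = (a == b).
  move=> an bn; apply/eqP/eqP => [ab|->//].
  wlog leab : a b an bn ab / (a <= b)%N.
    by move=> H; case/orP: (leq_total a b) => /H H'; [|symmetry]; apply: H'.
  by have := geow a b; rewrite leab bn ab dist_xx => /(_ isT); lia.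
have in' : (i <= n)%N by lia.
have jn' : (j <= n)%N by lia.
rewrite /rdist pu pv qu qv !w_eq //.
move: leij; rewrite leq_eqVlt => /predU1P[ij|ltij].
  rewrite -{}ij !eqxx /= in q1 qu qv nj jn' *.
  rewrite eqn_add2l; have [pq|] := eqVneq (pos p == 0) (pos q == 0).
    by rewrite pq eqxx; congr `|_|; lra.
  have dS : (i < n)%N -> dist (w i) (w i.+1) = 1%N /\ dist (w i.+1) (w i) = 1%N.
    by move=> lt; rewrite (dist_sym conX (w i.+1)) geow ?leqnSn // subSnn.
  have i0 : (i == i.+1) = false by lia.
  have [pz|pz] := eqVneq (pos p) 0; have [qz|qz] := eqVneq (pos q) 0;
   rewrite /= ?addn0 ?addn1 ?eqxx ?[i.+1 == i]eq_sym ?i0 //= => _;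
   rewrite /= ?pz ?qz ?addn1 in nj ni *; have [d1 d2] := dS ltac:(assumption);
   rewrite ?d1 ?d2 ?dist_xx;
   first [rewrite ger0_norm; last by lra | rewrite ler0_norm; last by lra];
   apply/eqP; rewrite eq_le !le_min !ge_min; lra.
have -> : (i == j) = false by lia.
have -> : (i == j + (pos q != 0%R))%N = false by lia.
rewrite /= !geow; try lia.
rewrite !natrB; try lia.
have ltR : i.+1%:R <= j%:R :> R by rewrite ler_nat.
rewrite -natr1 in ltR.
rewrite ler0_norm; last lra.
have [pz|pz] := eqVneq (pos p) 0; have [qz|qz] := eqVneq (pos q) 0;
  rewrite /= ?addn0 ?addn1 -?natr1 ?pz ?qz;
  apply/eqP; rewrite eq_le !le_min !ge_min; lra.
Qed.

Lemma along_nat w n k p : along w n k%:R p -> p = vert (w k).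
Proof.
case=> i [ki /andP[p0 p1] pu pv _].
have ik : i = k.
  have ik1 : i%:R < k.+1%:R :> R by rewrite -natr1; lra.
  have ki1 : k%:R < i.+1%:R :> R by rewrite -natr1; lra.
  by move: ik1 ki1; rewrite !ltr_nat; lia.
have pos0 : pos p = 0 by rewrite ik in ki; lra.
by apply: rpoint_ext; rewrite ?pu ?pv ?pos0 ?eqxx ?addn0 ?ik.
Qed.

Definition track w n : set (rpoint R X) :=
  [set p | exists2 t, 0 <= t <= n%:R & along w n t p]%classic.

Lemma geodesic_segment_track w n : geodesic w n ->
  exists2 A, geodesic_segment (vert (w 0%N)) (vert (w n)) A &
    (forall k, (k <= n)%N -> A (vert (w k))) /\ (A `<=` track w n)%classic.
Proof.
move=> geow.
have /choice[f fP] t : exists p, 0 <= t <= n%:R -> along w n t p.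
  have [tn|tn] := boolP (0 <= t <= n%:R); last by exists (vert (w 0%N)).
  by have [p wp] := along_exists geow tn; exists p.
have f_nat k : (k <= n)%N -> f k%:R = vert (w k).
  by move=> kn; apply: (@along_nat _ n); apply: fP; rewrite ler0n ler_nat.
have len : rdist (vert (w 0%N)) (vert (w n)) = n%:R.
  by rewrite rdist_vert geow ?leqnn // subn0.
exists (f @` [set t | 0 <= t <= n%:R])%classic; last first.
  split=> [k kn|_ [t tn <-]]; last by exists t => //; apply: fP.
  by exists k%:R; rewrite /= ?ler0n ?ler_nat ?f_nat.
exists f; rewrite len; split=> //; [exact: (f_nat 0%N) | exact: f_nat |].
by move=> s t /fP fs /fP ft; apply: rdist_along fs ft.
Qed.

(** The distance from a vertex to a point of an edge is reached through one of
    the ends of that edge. *)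
Lemma rdist_track_vertex x w n p delta : track w n p -> rdist (vert x) p <= delta ->
  exists2 k, (k <= n)%N & (dist x (w k))%:R <= delta.
Proof.
case=> _ _ [i [_ /andP[p0 p1] pu pv ni]].
have [in' in''] : (i <= n)%N /\ (i + (pos p != 0%R) <= n)%N by lia.
rewrite /rdist /= pu; case: ifP => [/andP[/eqP-> _]|_].
  by move=> le; exists i; rewrite ?dist_xx ?(le_trans _ le) ?normr_ge0.
case: ifP => [/andP[_ /eqP->]|_].
  by move=> le; exists i; rewrite ?dist_xx ?(le_trans _ le) ?normr_ge0.
rewrite pv !ge_min => le; have [near_i|near_i'] : (dist x (w i))%:R <= delta \/
    (dist x (w (i + (pos p != 0%R))%N))%:R <= delta.
- by case/orP: le => /orP[] le; [left|right|left|right]; lra.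
- by exists i.
by exists (i + (pos p != 0%R))%N.
Qed.

Lemma geodesic_rev w n : geodesic w n -> geodesic (fun k => w (n - k)%N) n.
Proof.
by move=> geow i j /andP[ij jn]; rewrite (dist_sym conX) geow; lia.
Qed.

(** All three sides are directed away from the corner [u 0] or from [u l], which
    suits triangles formed by two geodesics issuing from a base point. *)
Lemma thin_triangles : hyperbolic R X -> exists delta : nat,
  forall u v w l m n, geodesic u l -> geodesic v m -> geodesic w n ->
    u 0%N = w 0%N -> u l = v 0%N -> v m = w n ->
  forall i, (i <= l)%N -> exists j,
    (j <= m)%N /\ (dist (u i) (v j) <= delta)%N \/
    (j <= n)%N /\ (dist (u i) (w j) <= delta)%N.
Proof.
case=> _ [delta delta0 thin]; exists (Num.truncn delta).
move=> u v w l m n geou geov geow uw uv vw i il.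
have le_delta x y : (dist x y)%:R <= delta -> (dist x y <= Num.truncn delta)%N.
  by move=> le; rewrite truncn_ge_nat.
have [A segA [Avert _]] := geodesic_segment_track geou.
have [B segB [_ Btrack]] := geodesic_segment_track geov.
have [C segC [_ Ctrack]] := geodesic_segment_track (geodesic_rev geow).
rewrite subn0 subnn -uw -vw in segC; rewrite -uv in segB.
have [near _ _] := thin _ _ _ _ _ _ segA segB segC.
have [b [/Btrack|/Ctrack] /rdist_track_vertex near_b /near_b[j jn le]] :=
    near _ (Avert i il).
  by exists j; left; split=> //; apply: le_delta.
by exists (n - j)%N; right; split; [exact: leq_subr | exact: le_delta].
Qed.

End ThinTriangles.

(** * One cop in a hyperbolic graph *)

Section Pursuit.
Variables (R : realType) (X : graph).
Hypothesis hypX : hyperbolic R X.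
Let conX : connected_graph X := hypX.1.
Implicit Types (u w : nat -> X).

(** By thinness [u t] is close to [w], as it is too far from [u l] to be close to
    the third side.  A vertex of [w] close to [u t] is at almost the same distance
    from the common origin, which costs another [delta]. *)
Lemma fellow_travel : exists delta, forall u w l n, geodesic u l -> geodesic w n ->
  u 0 = w 0 -> forall t, t + dist (u l) (w n) + delta < l ->
  dist (u t) (w t) <= delta.*2.
Proof.
have [delta thin] := thin_triangles conX hypX; exists delta.
move=> u w l n geou geow uw t lt.
have [p side szp] := shortest_path conX (u l) (w n).
have geos := shortest_path_geodesic conX side szp.
set s := nth _ _ in geos; set m := dist (u l) (w n) in lt szp geos.
have s0 : s 0 = u l by [].
have sm : s m = w n by rewrite /s -szp nth_last /=; case: side.
have tl : t <= l by lia.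
have [j [[jm near]|[jn near]]] := thin _ _ _ _ _ _ geou geos geow uw (esym s0) sm t tl.
  have := dist_triangle conX (s j) (u t) (u l).
  rewrite (dist_sym conX (s j)) -s0 geos ?jm // s0 geou ?tl ?leqnn //; lia.
have lmn : l <= m + n.
  have := dist_triangle conX (w n) (u 0) (u l); rewrite geou ?leqnn // uw geow ?leqnn //.
  by rewrite (dist_sym conX (w n)) -/m; lia.
have tj : t <= j + delta.
  have := dist_triangle conX (w j) (u 0) (u t); rewrite geou ?tl // uw geow ?jn //.
  by rewrite (dist_sym conX (w j)); lia.
have jt : j <= t + delta.
  have := dist_triangle conX (u t) (w 0) (w j); rewrite -uw geou ?tl // uw geow ?jn //.
  lia.
have wjt : dist (w j) (w t) <= delta.
  have [le|/ltnW le] := leqP j t; last rewrite (dist_sym conX).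
    by rewrite geow ?le /=; lia.
  by rewrite geow ?le //=; lia.
have := dist_triangle conX (w j) (u t) (w t); lia.
Qed.

(** Geodesics are continued by their endpoint, so that [ray x t] is never beyond
    [x]. *)
Lemma choose_geodesics (v : X) : exists ray : X -> nat -> X, forall x,
  [/\ geodesic (ray x) (dist v x), ray x 0 = v
    & forall t, dist v x <= t -> ray x t = x].
Proof.
suff /choice[ray rayP] x : exists w,
    [/\ geodesic w (dist v x), w 0 = v & forall t, dist v x <= t -> w t = x].
  by exists ray.
have [p vxp szp] := shortest_path conX v x.
exists (nth x (v :: p)); split=> //; first exact: shortest_path_geodesic.
move=> t; rewrite -szp leq_eqVlt => /predU1P[<-|lt]; last by rewrite nth_default.
by rewrite nth_last /=; case: vxp.
Qed.

(** A strategy must be legal against every history, including those with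
    impossible moves of the robber; hence the cop stays where he is when the next
    point of his march is out of reach. *)
Theorem hyperbolic_strong_cop_win : strong_cop_win X 1.
Proof.
have [delta travel] := fellow_travel.
exists delta.*2.+1 => // psi _; exists (psi + delta).+1 => R0 _ v.
set sigma := _.*2.+1; set rho := (psi + delta).+1.
have [ray rayP] := choose_geodesics v.
pose step c x := let c' := ray x (dist v c).+1 in if dist c c' <= sigma then c' else c.
have step_legal c x : dist c (step c x) <= sigma.
  by rewrite /step; case: ifP => // _; rewrite dist_xx.
pose F : cop_strategy X 1 := fun h _ => foldl step v h.
have dist_ray x t : t <= dist v x -> dist v (ray x t) = t.
  by have [geo ray0 _] := rayP x => le; rewrite -{1}ray0 geo ?subn0.
have far_ray x t : rho < dist x (ray x t) -> t + rho < dist v x.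
  have [geo ray0 rayx] := rayP x.
  have [le|/ltnW le] := leqP (dist v x) t; first by rewrite rayx // dist_xx.
  have := geo t (dist v x); rewrite le leqnn (rayx _ (leqnn _)) => /(_ isT).
  by rewrite (dist_sym conX) => ->; lia.
exists F => [h x i|r legal].
  by rewrite /F foldl_rcons.
have [|uncaught] := pselect (exists k, captured rho F r k); [by left | right].
have {}uncaught k : ~ captured rho F r k by move=> cap; apply: uncaught; exists k.
have far k i : rho < dist (r k) (cops_at F r k.+1 i).
  by rewrite ltnNge; apply/negP => le; apply: (uncaught k); exists i.
have posS k i : cops_at F r k.+1 i = step (cops_at F r k i) (r k).
  by rewrite /cops_at /F mkseqS foldl_rcons.
have pos k i : cops_at F r k.+1 i = ray (r k) k.+1 /\ k.+1 + rho < dist v (r k).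
  suff pk : cops_at F r k.+1 i = ray (r k) k.+1.
    by split=> //; apply: far_ray; rewrite -pk.
  elim: k => [|k IH].
    rewrite posS /cops_at /F /step /= dist_xx; case: ifP => // /negP[].
    have [geo ray0 rayx] := rayP (r 0).
    have [le|lt] := leqP (dist v (r 0)) 1; first by rewrite rayx //; lia.
    by rewrite -{1}ray0 geo //=; lia.
  have := far_ray (r k) k.+1; rewrite -IH => /(_ (far k i)) lt.
  have [p [rp szp _]] := legal k (fun j _ => uncaught j).
  have rr := leq_trans (dist_le_size rp) szp.
  rewrite posS IH /step dist_ray; last by lia.
  case: ifP => // /negP[].
  have [geo ray0 rayx] := rayP (r k); have [geo' ray0' rayx'] := rayP (r k.+1).
  have := travel _ _ _ _ geo geo' (etrans ray0 (esym ray0')) k.+1.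
  rewrite rayx // rayx' // => /(_ ltac:(rewrite /rho in lt; lia)) near.
  have le' : k.+1 < dist v (r k.+1).
    have := dist_triangle conX (r k.+1) v (r k).
    by rewrite (dist_sym conX (r k.+1)) /rho in lt *; lia.
  have := dist_triangle conX (ray (r k.+1) k.+1) (ray (r k) k.+1) (ray (r k.+1) k.+2).
  by rewrite [X in _ <= _ + X]geo' ?leqnSn ?le' // subSnn /sigma; lia.
exists R0.+1 => // k le; have [_ lt] := pos k ord0; lia.
Qed.

End Pursuit.

(** * Cayley graphs *)

Section CayleyGraphs.
Variable G : groupType.
Local Open Scope group_scope.

Lemma cayley_locally_finite (S : seq G) : locally_finite (cayley S).
Proof.
move=> g; exists (([seq g * s | s <- S] ++ [seq g * s^-1 | s <- S]) : seq G).
move=> h /andP[_ /hasP[s sS /orP[/eqP->|/eqP->]]]; rewrite mem_cat.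
  by rewrite map_f.
by apply/orP; right; apply/mapP; exists s; rewrite ?mulgK.
Qed.

Lemma cayley_vertex_transitive (S : seq G) : vertex_transitive (cayley S).
Proof.
move=> g h; exists (fun x : G => h * g^-1 * x), (fun x : G => (h * g^-1)^-1 * x).
split=> [x|x|x y|]; rewrite ?mulKg ?mulVKg ?mulgVK //.
rewrite /= /cayley_adj /= (inj_eq (@mulgI _ _)); congr (_ && _).
by apply: eq_has => s; rewrite -!mulgA !(inj_eq (@mulgI _ _)).
Qed.

End CayleyGraphs.

Lemma least_positive_None P : (forall n, ~ P n) -> least_positive P = None.
Proof.
move=> nP; rewrite /least_positive; case: pselect => // ex; exfalso.
by case: ex => n /asboolP[_ /nP].
Qed.

Lemma least_positive_1 (P : nat -> Prop) : P 1 -> least_positive P = Some 1.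
Proof.
move=> P1; rewrite /least_positive; case: pselect => [ex|[]]; last first.
  by exists 1; apply/asboolP.
case: ex_minnP => m /asboolP[m0 _] min1; congr Some; apply/eqP.
by rewrite eqn_leq m0 min1 //; apply/asboolP.
Qed.

Theorem corollary10 (R : realType) (G : groupType) :
  finitely_generated G -> one_ended_group G -> hyperbolic_group G R ->
  wCop_group_is G None /\ sCop_group_is G (Some 1).
Proof.
move=> _ oneG hypG; split=> S genS.
  apply: least_positive_None => n.
  apply: (one_ended_not_weak_cop_win (oneG S genS).1 (oneG S genS)).
  - exact: cayley_locally_finite.
  - exact: cayley_vertex_transitive.
  - exact: (1%g : G).
by apply: least_positive_1; apply: hyperbolic_strong_cop_win (hypG S genS).
Qed.
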